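(* For every integer $n\ge 1$ let $A_n(x)=2\sum_{j=0}^{n-1}T_j(x)+T_n(x)$, i.e. the degree $n$ polynomial with Chebyshev coordinates $[2,2,2,\ldots,2,2,1]$. Then all the complex roots of $A_n(x)$ are real and lie in $[-2,2]$. Moreover, as $n\to+\infty$, the largest root of $A_n(x)$ tends to $2$ and the smallest root tends to $-2$.
   Context: The Chebyshev polynomials used here are the monic integer polynomials $T_0(x)=1$ and, for $n>0$, $T_n(x)=x^n+\sum_{k=1}^{\lfloor n/2\rfloor}(-1)^k\frac nk\binom{n-k-1}{k-1}x^{n-2k}$; equivalently, for $n>0$, $T_n(2\cos\theta)=2\cos(n\theta)$ and $T_n(z+z^{-1})=z^n+z^{-n}$. Note the convention $T_0=1$ (not $2$). A polynomial has Chebyshev coordinates $[c_0,c_1,\ldots,c_d]$ if it equals $\sum_{j=0}^d c_jT_j(x)$. *)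

(* Defs.v *)
From mathcomp Require Import all_boot all_order all_algebra.
From mathcomp Require Import all_classical all_reals all_analysis.
From mathcomp Require Import complex.
From mathcomp Require Import zify.

Set Implicit Arguments.
Unset Strict Implicit.
Unset Printing Implicit Defensive.

Import Order.TTheory GRing.Theory Num.Theory.

Local Open Scope ring_scope.

(* The integer (n / k) * binomial (n - k - 1) (k - 1). The Euclidean division
   is exact by dvdn_cheb_coef, and the subtractions are not truncated in the
   range 1 <= k <= n / 2. *)
Definition cheb_coef (n k : nat) : nat :=
  ((n * 'C(n - k - 1, k - 1)) %/ k)%N.

Lemma dvdn_cheb_coef (n k : nat) :
  (0 < k)%N -> (k <= n./2)%N -> (k %| n * 'C(n - k - 1, k - 1))%N.
Proof.
case: k => // k _ lekn.
have -> : (n - k.+1 - 1 = (n - k.+2))%N by lia.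
have -> : (n * 'C(n - k.+2, k.+1 - 1) =
  (n - k.+2).+1 * 'C(n - k.+2, k) + k.+1 * 'C(n - k.+2, k))%N.
  by rewrite -mulnDl subn1; congr (_ * _)%N; lia.
by rewrite mul_bin_diag -mulnDr dvdn_mulr.
Qed.

(* Normalized by T_n(z + z^-1) = z^n + z^-n for n > 0, but T_0 = 1 and not 2. *)
Definition chebT (n : nat) : {poly int} :=
  if n is 0%N then 1
  else 'X^n + \sum_(1 <= k < (n./2).+1)
                ((-1) ^+ k * (cheb_coef n k)%:Z) *: 'X^(n - 2 * k).

Definition chebA (n : nat) : {poly int} :=
  2%:Z *: (\sum_(0 <= j < n) chebT j) + chebT n.

Definition is_largest_root (R : realType) (p : {poly R}) (x : R) : Prop :=
  root p x /\ forall y : R, root p y -> y <= x.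

Definition is_smallest_root (R : realType) (p : {poly R}) (x : R) : Prop :=
  root p x /\ forall y : R, root p y -> x <= y.

(* Main.v *)
Require Import Defs.
From mathcomp Require Import all_boot all_order all_algebra.
From mathcomp Require Import all_classical all_reals all_analysis.
From mathcomp Require Import complex.
From mathcomp Require Import zify ring lra.
Import Order.TTheory GRing.Theory Num.Theory.
Import numFieldNormedType.Exports.

Local Open Scope classical_set_scope.
Local Open Scope ring_scope.

(* If w v = 1 then A_n(w + v) (w - 1) = (w + 1) (w^n - v^n), so a root w + 1/w
   of A_n has w = 1, w = -1 or w^(2n) = 1. Hence |w| = 1 and the root is
   w + conj w = 2 Re w. Taking w = e^(it) gives
   A_n(2 cos t) (1 - cos t) = 2 sin(n t) sin t, which does not vanish for
   0 < t < pi / n: the largest root is 2 cos(pi / n), the smallest is -2. *)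

(** * Second-kind polynomials and the recurrence for T_n *)

(** Write n = (n - k) + k and use k binom(n-k, k) = (n-k) binom(n-k-1, k-1). Up to sign, the two
    binomials are coefficients of S_n and S_(n-2). *)
Lemma cheb_coef_binE (n k : nat) : (0 < k)%N -> (k <= n./2)%N ->
  cheb_coef n k = ('C(n - k, k) + 'C(n - k - 1, k - 1))%N.
Proof.
case: k => // k _ lekn; apply/eqP.
rewrite /cheb_coef eq_sym eqn_div ?dvdn_cheb_coef //.
have -> : (n - k.+1 = (n - k.+2).+1)%N by lia.
have -> : ((n - k.+2).+1 - 1 = n - k.+2)%N by lia.
rewrite subn1 mulnDl [('C(_.+1, _) * _)%N]mulnC -mul_bin_diag.
by rewrite [('C(_, _) * _)%N]mulnC -mulnDl; apply/eqP; congr (_ * _)%N; lia.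
Qed.

(* The Chebyshev polynomials of the second kind on the same scale:
   S_n(w + 1/w) = (w^(n+1) - w^-(n+1)) / (w - 1/w). The coefficients with
   k > n / 2 vanish, whence the generous summation range. *)
Definition chebS (n : nat) : {poly int} :=
  \sum_(0 <= k < n.+1) ((-1) ^+ k * ('C(n - k, k))%:Z) *: 'X^(n - 2 * k).

Lemma chebS_half (n : nat) : chebS n =
  \sum_(0 <= k < (n./2).+1) ((-1) ^+ k * ('C(n - k, k))%:Z) *: 'X^(n - 2 * k).
Proof.
rewrite /chebS (big_cat_nat (n := (n./2).+1)) //=; last by lia.
rewrite [X in _ + X]big1_seq ?addr0 // => k.
rewrite mem_index_iota => /andP[_ hk].
by rewrite bin_small ?mulr0 ?scale0r //; lia.
Qed.

(** Coefficientwise this is Pascal's rule for binom(n-k+1, k+1). *)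
Lemma chebS_rec (n : nat) : chebS n.+2 = 'X * chebS n.+1 - chebS n.
Proof.
rewrite /chebS big_nat_recl // [X in 'X * X]big_nat_recl //.
rewrite !subn0 !bin0 mulrDr -!scalerAr -exprS -addrA; congr (_ + _).
rewrite mulr_sumr -sumrB big_nat_recr //=.
rewrite [X in _ + X](_ : _ = 0) ?addr0; last first.
  by rewrite bin_small ?mulr0 ?scale0r //; lia.
apply: eq_big_nat => k hk.
have -> : (n.+2 - k.+1 = (n - k).+1)%N by lia.
have -> : (n.+1 - k.+1 = n - k)%N by lia.
have -> : (n.+2 - 2 * k.+1 = n - 2 * k)%N by lia.
rewrite binS PoszD mulrDr scalerDl; congr (_ + _); last first.
  by rewrite exprS mulN1r mulNr scaleNr.
(* Past this range the exponent n + 1 - 2(k + 1) is truncated to 0, but binom(n-k, k+1) then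
   vanishes. *)
have [h|h] := leqP (2 * k.+1) n.+1; last first.
  by rewrite bin_small ?mulr0 ?scale0r ?mulr0 //; lia.
by rewrite -scalerAr -exprS; congr (_ *: 'X^_); lia.
Qed.

Lemma chebT_chebS (n : nat) : chebT n.+2 = chebS n.+2 - chebS n.
Proof.
rewrite /chebT !chebS_half [X in X - _]big_nat_recl // subn0 bin0 mulr1 scale1r.
rewrite -addrA big_add1 /= -sumrB; congr (_ + _); apply: eq_big_nat => k hk.
rewrite cheb_coef_binE //.
have -> : (n.+2 - 2 * k.+1 = n - 2 * k)%N by lia.
have -> : (n.+2 - k.+1 - 1 = n - k)%N by lia.
by rewrite subn1 PoszD mulrDr scalerDl exprS !mulN1r !mulNr !scaleNr.
Qed.

Lemma chebT1 : chebT 1 = 'X.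
Proof. by rewrite /chebT big_geq // addr0. Qed.

Lemma chebS0 : chebS 0 = 1.
Proof. by rewrite /chebS big_nat1 scale1r. Qed.

Lemma chebS1 : chebS 1 = 'X.
Proof.
by rewrite /chebS big_nat_recr //= big_nat1 mulr0 scale0r addr0 scale1r.
Qed.

Lemma chebT2 : chebT 2 = 'X^2 - 2.
Proof. by rewrite chebT_chebS chebS_rec chebS0 chebS1; ring. Qed.

(** The recurrence starts at T_3, since T_2 = X T_1 - 2 whereas T_0 = 1. *)
Lemma chebT_rec (n : nat) : chebT n.+3 = 'X * chebT n.+2 - chebT n.+1.
Proof.
case: n => [|n]; last by rewrite !chebT_chebS !chebS_rec; ring.
by rewrite chebT2 chebT1 chebT_chebS !chebS_rec chebS0 chebS1; ring.
Qed.

Lemma chebA1 : chebA 1 = 2 + 'X.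
Proof. by rewrite /chebA big_nat1 chebT1 -mul_polyC; ring. Qed.

Lemma chebAS (n : nat) : chebA n.+1 = chebA n + (chebT n + chebT n.+1).
Proof. by rewrite /chebA big_nat_recr //= -!mul_polyC; ring. Qed.

Lemma nat_ind2 (P : nat -> Prop) : P 0%N -> P 1%N ->
  (forall n, P n -> P n.+1 -> P n.+2) -> forall n, P n.
Proof.
move=> P0 P1 PS n; suff [] : P n /\ P n.+1 by [].
by elim: n => [|n [Pn Pn1]]; split=> //; apply: PS.
Qed.

(** * Values at w + 1/w in a commutative ring *)

Section Evaluation.
Variable K : comNzRingType.
Local Notation ev p x := ((map_poly (intr : int -> K) p).[x]).

Lemma ev_chebA1 (x : K) : ev (chebA 1) x = 2 + x.
Proof. by rewrite chebA1 rmorphD rmorph_nat /= map_polyX !hornerE. Qed.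

Lemma ev_chebAS (n : nat) (x : K) :
  ev (chebA n.+1) x = ev (chebA n) x + (ev (chebT n) x + ev (chebT n.+1) x).
Proof. by rewrite chebAS !rmorphD !hornerE. Qed.

Lemma ev_chebT_rec (n : nat) (x : K) :
  ev (chebT n.+3) x = x * ev (chebT n.+2) x - ev (chebT n.+1) x.
Proof. by rewrite chebT_rec rmorphB rmorphM /= map_polyX !hornerE. Qed.

Lemma ev_chebT1 (x : K) : ev (chebT 1) x = x.
Proof. by rewrite chebT1 map_polyX hornerX. Qed.

Lemma ev_chebT2 (x : K) : ev (chebT 2) x = x ^+ 2 - 2.
Proof.
by rewrite chebT2 rmorphB rmorphXn rmorph_nat /= map_polyX !hornerE.
Qed.

Lemma ev_chebT_addV (w v : K) (n : nat) : w * v = 1 ->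
  ev (chebT n.+1) (w + v) = w ^+ n.+1 + v ^+ n.+1.
Proof.
move=> wv1; elim/nat_ind2: n => [||n IH0 IH1].
- by rewrite ev_chebT1.
- by rewrite ev_chebT2 -[2]/(1 + 1) -{1}wv1 -wv1; ring.
rewrite ev_chebT_rec IH0 IH1 -[X in _ - X]mul1r -wv1 !exprS; ring.
Qed.

(** Multiplying by w - 1 makes the sum telescope modulo w v = 1. Starting from A_1 = x + 2 keeps the
    exceptional T_0 out of the induction step. *)
Lemma ev_chebA_addV (w v : K) (n : nat) : w * v = 1 ->
  ev (chebA n.+1) (w + v) * (w - 1) = (w + 1) * (w ^+ n.+1 - v ^+ n.+1).
Proof.
move=> wv1; elim: n => [|n IH]; first by rewrite ev_chebA1; ring: wv1.
rewrite ev_chebAS mulrDl IH !ev_chebT_addV //.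
rewrite !exprS; move: (w ^+ n) (v ^+ n) => a b; ring: wv1.
Qed.

Lemma ev_chebT_2 (n : nat) : ev (chebT n.+1) 2 = 2.
Proof. by have := @ev_chebT_addV 1 1 n (mulr1 1); rewrite !expr1n. Qed.

(** At w = v = 1 the factor w - 1 is 0 and the identity in w says nothing, so the value at 2 is
    summed directly. It later rules out the root 2. *)
Lemma ev_chebA_2 (n : nat) : ev (chebA n.+1) 2 = (4 * n.+1)%:R.
Proof.
elim: n => [|n IH]; first by rewrite ev_chebA1 muln1 -natrD.
by rewrite ev_chebAS IH !ev_chebT_2 -!natrD; congr _%:R; lia.
Qed.

End Evaluation.

Lemma chebA_root_bounds (R : realType) (n : nat) (z : R[i]) :
  root (map_poly intr (chebA n.+1)) z ->
  complex.Im z = 0 /\ -2 <= complex.Re z <= 2.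
Proof.
(* As s^2 = z^2 - 4, [w] and [v] are the two roots of X^2 - z X + 1. *)
move=> /rootP rz; pose s := sqrtc (z ^+ 2 - 4).
pose w := (z + s) / 2; pose v := (z - s) / 2.
have zwv : z = w + v by rewrite /w /v; field.
have wv1 : w * v = 1.
  have -> : w * v = (z ^+ 2 - s ^+ 2) / 4 by rewrite /w /v; field.
  by rewrite sqr_sqrtc; field.
have nw1 : `|w| = 1.
  (* Either w = -1, or w^(n+1) = v^(n+1); then |w| = |v|, while |w| |v| = 1. *)
  have := @ev_chebA_addV _ w v n wv1; rewrite -zwv rz mul0r => /esym/eqP.
  rewrite mulf_eq0 addr_eq0 subr_eq0 => /orP[/eqP->|/eqP/(congr1 Num.norm)].
    by rewrite normrN normr1.
  rewrite !normrX => /eqP; rewrite eqrXn2 // => /eqP nwv.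
  have /eqP := congr1 Num.norm wv1.
  by rewrite normrM -nwv normr1 -expr2 sqrp_eq1 // => /eqP.
have vE : v = (w^*)%C.
  have w0 : w != 0 by rewrite -normr_gt0 nw1.
  by apply: (mulfI w0); rewrite wv1 -sqr_normc nw1 expr1n.
(* With w = a + ib this reads a^2 + b^2 = 1, and z = w + conj w = 2a. *)
have := add_Re2_Im2 w; rewrite nw1 expr1n => /complexI.
rewrite zwv vE; case: (w) => a b /= ab; split; first by rewrite subrr.
by nra.
Qed.

Lemma chebA_real_root_bounds (R : realType) (n : nat) (x : R) :
  root (map_poly intr (chebA n.+1)) x -> -2 <= x <= 2.
Proof.
move=> rx; suff /chebA_root_bounds[] : root (map_poly intr (chebA n.+1)) x%:C%C.
  by [].
rewrite (_ : map_poly _ _ = map_poly (real_complex R) (map_poly intr (chebA n.+1))).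
  by rewrite fmorph_root.
by rewrite -map_poly_comp; apply: eq_map_poly => m /=; rewrite rmorph_int.
Qed.

(** * The extreme roots via x = 2 cos t *)

Section Trigonometry.
Variable R : realType.
Local Notation ev p x := ((map_poly (intr : int -> R) p).[x]).

Lemma ev_chebT_cos (n : nat) (t : R) :
  ev (chebT n.+1) (2 * cos t) = 2 * cos (n.+1%:R * t).
Proof.
elim/nat_ind2: n => [||n IH0 IH1].
- by rewrite ev_chebT1 mul1r.
- by rewrite ev_chebT2 [2 * t]mulr_natl cos_mulr2n; ring.
rewrite ev_chebT_rec IH0 IH1.
have -> : n.+3%:R * t = n.+2%:R * t + t by rewrite -natr1; ring.
have -> : n.+1%:R * t = n.+2%:R * t - t by rewrite -(natr1 n.+1); ring.
by rewrite cosB cosD; ring.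
Qed.

(** This is the identity at w = e^(it), multiplied by conj w - 1; the induction stays in R by the
    addition formulas. *)
Lemma ev_chebA_cos (n : nat) (t : R) :
  ev (chebA n.+1) (2 * cos t) * (1 - cos t) =
  2 * (sin (n.+1%:R * t) * sin t).
Proof.
elim: n => [|n IH].
  by rewrite ev_chebA1 mul1r -expr2 sin2cos2; ring.
rewrite ev_chebAS mulrDl IH !ev_chebT_cos.
have -> : n.+2%:R * t = n.+1%:R * t + t by rewrite -(natr1 n.+1); ring.
rewrite sinD cosD.
have := sin2cos2 t.
set S := sin t; set c := cos t => e; ring: e.
Qed.

Lemma chebA_root_N2 (n : nat) : ev (chebA n.+1) (-2) = 0.
Proof.
have := ev_chebA_cos n pi; rewrite cospi sinpi mulrN1 !mulr0.
by move=> /eqP; rewrite mulf_eq0 opprK => /orP[/eqP//|]; lra.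
Qed.

Lemma chebA_root_cos (n : nat) : ev (chebA n.+1) (2 * cos (pi / n.+1%:R)) = 0.
Proof.
have := ev_chebA_cos n (pi / n.+1%:R).
rewrite [_ * (pi / _)]mulrCA divff ?pnatr_eq0 // mulr1 sinpi mul0r mulr0.
move=> /eqP; rewrite mulf_eq0 => /orP[/eqP//|].
have np : 0 < pi / n.+1%:R :> R by rewrite divr_gt0 ?pi_gt0.
have npi : pi / n.+1%:R <= pi :> R.
  by rewrite ler_pdivrMr // ler_peMr ?pi_ge0 // ler1n.
(* The factor 1 - cos t is nonzero because 0 < t <= pi. *)
rewrite gt_eqF // subr_gt0 -[ltRHS]cos0.
by rewrite ltr_cos // in_itv /= ?lexx ?pi_ge0 // npi ltW.
Qed.

Lemma chebA_root_le (n : nat) (y : R) :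
  root (map_poly intr (chebA n.+1)) y -> y <= 2 * cos (pi / n.+1%:R).
Proof.
move=> ry; have y2 := chebA_real_root_bounds _ _ _ ry.
have hy : -1 <= y / 2 <= 1 by lra.
pose t := acos (y / 2).
have yE : y = 2 * cos t by rewrite /t acosK ?in_itv //=; field.
have t0 : 0 <= t by apply: acos_ge0.
have tpi : t <= pi by apply: acos_lepi.
rewrite leNgt yE ltr_pM2l //; apply/negP.
have np : 0 < pi / n.+1%:R :> R by rewrite divr_gt0 ?pi_gt0.
have npi : pi / n.+1%:R <= pi :> R.
  by rewrite ler_pdivrMr // ler_peMr ?pi_ge0 // ler1n.
rewrite ltr_cos ?in_itv /= ?t0 ?tpi ?npi ?ltW // => tn.
move/rootP: ry => ry.
(* At t = 0 the trigonometric identity is 0 = 0; the value 4(n+1) at 2 settles this case. *)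
have [te|tn0] := eqVneq t 0.
  move: ry; rewrite yE te cos0 mulr1 ev_chebA_2 => /eqP.
  by rewrite pnatr_eq0.
have tgt : 0 < t by rewrite lt_def tn0.
(* Both sines are positive, as 0 < (n+1) t < pi and 0 < t < pi. *)
have := ev_chebA_cos n t; rewrite -yE ry mul0r => /esym/eqP; apply/negP.
rewrite gt_eqF // mulr_gt0 // mulr_gt0 // sin_gt0_pi //.
  by rewrite mulr_gt0 //= mulrC -ltr_pdivlMr.
by rewrite tgt (lt_le_trans tn).
Qed.

End Trigonometry.

Theorem mainTheorem2 (R : realType) :
  (forall n : nat, (1 <= n)%N ->
     forall z : R[i], root (map_poly intr (chebA n)) z ->
       complex.Im z = 0 /\ -2 <= complex.Re z <= 2) /\
  (exists u : nat -> R,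
     (forall n : nat, (1 <= n)%N ->
        is_largest_root (map_poly intr (chebA n)) (u n)) /\
     (u n @[n --> \oo] --> (2 : R))) /\
  (exists v : nat -> R,
     (forall n : nat, (1 <= n)%N ->
        is_smallest_root (map_poly intr (chebA n)) (v n)) /\
     (v n @[n --> \oo] --> (-2 : R))).
Proof.
split; first by move=> [//|n] _; exact: chebA_root_bounds.
split; last first.
  exists (fun=> -2); split; last exact: cvg_cst.
  move=> [//|n] _; split; first by apply/rootP; exact: chebA_root_N2.
  by move=> y /chebA_real_root_bounds /andP[].
(* At n = 0 the division by zero gives 0, so that term is 2. *)
exists (fun n => 2 * cos (pi / n%:R)); split.
  move=> [//|n] _; split; first by apply/rootP; exact: chebA_root_cos.
  exact: chebA_root_le.
(* After the shift, the angle is pi times the harmonic sequence 1/(n+1). *)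
rewrite -(cvg_shiftS (fun n => 2 * cos (pi / n%:R) : R)).
have pi0 : (pi / n.+1%:R : R) @[n --> \oo] --> (0 : R).
  have h := cvgMl_tmp (a := pi) (@cvg_harmonic R).
  by rewrite mulr0 in h; exact: h.
suff : 2 * cos (pi / n.+1%:R : R) @[n --> \oo] --> (2 * cos 0 : R).
  by rewrite cos0 mulr1.
by apply: cvgMl_tmp; apply: continuous_cvg pi0; exact: continuous_cos.
Qed.
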